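(* Let $H=\langle X\mid\mathcal R\rangle$ be a hyperbolic group such that geodesic triangles in $\Gamma_X(H)$ are $\delta$-thin. Let $M$ be the number of elements of $H$ represented by words of length at most $4\delta$ in $F(X)$ and let $l=\delta(\log_2(6)+1)$. If $h$ is a commutator in $H$, then there are words $R$ and $F$ in $F(X)$ which are minimal in $H$ such that $h=_HRFR^{-1}$, where $$|R|\le 59l+8M+28+2\delta+\frac{|h|_H}{2},$$ and $F$ takes one of the following forms (all letters below denoting words in $F(X)$). 1. $|F|\le 6(12l+M+4)$ with $F=_HPQTP^{-1}Q^{-1}T^{-1}$ and $|P|,|Q|,|T|\le 12l+M+4$. 2. $F=A_1A_2^{-1}$ with $A_1=_H\xi_1^{-1}A_2\xi_2$, where $|\xi_1|+|\xi_2|\le 12(12l+M+4)$ and $\xi_1$ is conjugate to $\xi_2$ in $H$. 3. $F=A_1B_1A_2^{-1}B_2^{-1}$ with $A_1=_H\xi_1A_2\xi_3$, $B_1=_H\xi_4B_2\xi_2$, where $|\xi_1|+|\xi_2|+|\xi_3|+|\xi_4|\le 12(12l+M+4)$ and $\xi_1\xi_2\xi_3\xi_4=_H1$. 4. $F=A_1B_1C_1A_2^{-1}B_2^{-1}C_2^{-1}$ with $A_1=_H\xi_1A_2\rho_1$, $B_1=_H\rho_2B_2\xi_2$ and $C_1=_H\xi_3C_2\rho_3$, where $|\xi_1|+|\xi_2|+|\xi_3|+|\rho_1|+|\rho_2|+|\rho_3|\le 12(12l+M+4)$ and $\xi_1\xi_2\xi_3=_H\rho_1\rho_2\rho_3=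_H1$.
   Context: $X$ is a finite generating set of $H$, $F(X)$ is the free group on $X$, and $|w|$ is the length of a word $w$ in $F(X)$. $w=_Hv$ means that $w$ and $v$ represent the same element of $H$. A word $w$ is minimal in $H$ if $|v|\ge|w|$ for all words $v$ in $F(X)$ with $v=_Hw$; $|w|_H$ is the length of a word minimal in $H$ which equals $w$ in $H$. In forms 2–4, $F$ equals the displayed product as a word in $F(X)$. The $\delta$-thin condition is used in this form: if $w=w_1w_2$ and $z=z_1z_2$ are words minimal in $H$ and $|w_2|=|z_1|\le\frac12(|w|+|z|-|wz|_H)$, then $|w_2z_1|_H\le\delta$. *)

(* Defs.v *)
From mathcomp Require Import all_boot all_order all_algebra.
From mathcomp Require Import monoid finmap.
From mathcomp Require Import boolp classical_sets functions cardinality.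
From mathcomp Require Import reals exp.

Set Implicit Arguments.
Unset Strict Implicit.
Unset Printing Implicit Defensive.

Import Order.TTheory GRing.Theory Num.Theory.

Local Open Scope classical_set_scope.
Local Open Scope group_scope.

(* The letter (x, false) stands for x and (x, true) for x^-1.  Words need not
   be reduced; a word which is minimal in H is automatically reduced, and so is
   every subword of it. *)
Definition letter (X : finType) : Type := (X * bool)%type.
Definition word (X : finType) : Type := seq (letter X).

Definition inv_letter (X : finType) (a : letter X) : letter X := (a.1, ~~ a.2).
Definition inv_word (X : finType) (w : word X) : word X :=
  rev (map (@inv_letter X) w).

(* [pres_eq rels u v] : u and v represent the same element of the group
   <X | rels>, i.e. they are identified by the smallest congruence on words
   which contains free cancellation and kills the relators. *)
Inductive pres_eq (X : finType) (rels : set (word X)) : word X -> word X -> Prop :=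
| pres_refl u : pres_eq rels u u
| pres_sym u v : pres_eq rels u v -> pres_eq rels v u
| pres_trans u v w : pres_eq rels u v -> pres_eq rels v w -> pres_eq rels u w
| pres_cat u u' v v' :
    pres_eq rels u u' -> pres_eq rels v v' -> pres_eq rels (u ++ v) (u' ++ v')
| pres_cancel a : pres_eq rels [:: a; inv_letter a] [::]
| pres_rel r : rels r -> pres_eq rels r [::].

Section WordsInGroup.
Variables (X : finType) (H : groupType) (gen : X -> H).

Definition eval_letter (a : letter X) : H :=
  if a.2 then (gen a.1)^-1 else gen a.1.

Definition eval (w : word X) : H := \prod_(a <- w) eval_letter a.

Definition eqH (u v : word X) : Prop := eval u = eval v.

(* H = <X | rels>, with gen the map from X to H. *)
Definition presents (rels : set (word X)) : Prop :=
  (forall g : H, exists w : word X, eval w = g) /\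
  (forall u v : word X, eqH u v <-> pres_eq rels u v).

Definition minimal (w : word X) : Prop :=
  forall v : word X, eqH v w -> (size w <= size v)%N.

Lemma has_lenH (w : word X) :
  exists n, `[< exists2 v : word X, eqH v w & size v = n >].
Proof. by exists (size w); apply/asboolP; exists w. Qed.

(* |w|_H *)
Definition lenH (w : word X) : nat := ex_minn (has_lenH w).

Lemma lenH_spec (w : word X) :
  exists v : word X, [/\ minimal v, eqH v w & size v = lenH w].
Proof.
rewrite /lenH; case: ex_minnP => n /asboolP[v vw <-] min.
exists v; split=> // u uv; apply: min; apply/asboolP; exists u => //.
by rewrite /eqH uv.
Qed.

Definition conjugateH (u v : word X) : Prop :=
  exists g : H, eval u = g^-1 * eval v * g.

Definition is_commutatorH (w : word X) : Prop :=
  exists x y : H, eval w = [~ x, y].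

Variable R : realType.
Implicit Types (r delta : R).

(* Geodesic triangles in the Cayley graph are delta-thin, read on their labels:
   w and z label two sides meeting at a vertex p (w ends and z starts there),
   half of |w| + |z| - |wz|_H is the Gromov product at p of the two other
   corners, and |w_2 z_1|_H is the distance between the two points at distance
   |w_2| = |z_1| from p on these sides. *)
Definition delta_thin delta : Prop :=
  forall w1 w2 z1 z2 : word X,
    let w := w1 ++ w2 in let z := z1 ++ z2 in
    minimal w -> minimal z -> size w2 = size z1 ->
    ((size z1)%:R <=
       ((size w)%:R + (size z)%:R - (lenH (w ++ z))%:R) / 2 :> R)%R ->
    ((lenH (w2 ++ z1))%:R <= delta)%R.

Definition ball r : set H :=
  [set g | exists2 w : word X, ((size w)%:R <= r)%R & eval w = g].

Lemma finite_ball r : finite_set (ball r).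
Proof.
have [n rn] : exists n : nat, (r <= n%:R)%R.
  by exists (Num.truncn r).+1; apply/ltW/truncnS_gt.
pose wordsn := \bigcup_(k in `I_n.+1) range (fun t : k.-tuple (X * bool) => tval t).
apply: (@sub_finite_set _ _ (eval @` wordsn)); last first.
  apply: finite_image; apply: bigcup_finite => [|k _]; first exact: finite_II.
  exact: finite_image.
move=> g [w wr <-]; exists w => //; exists (size w); last by exists (in_tuple w).
by rewrite /= ltnS -(ler_nat R) (le_trans wr rn).
Qed.

(* By finite_ball this is the genuine number of elements of the ball. *)
Definition ball_card r : nat := #|` fset_set (ball r) |.

(* In the four forms a concatenation is a word: F = A1 ++ inv_word A2 says that
   F is this product letter by letter, while eqH is equality in H. *)

Definition form1 (K : R) (F : word X) : Prop :=
  ((size F)%:R <= 6 * K)%R /\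
  exists P Q T : word X,
    [/\ eqH F (P ++ Q ++ T ++ inv_word P ++ inv_word Q ++ inv_word T),
        ((size P)%:R <= K)%R, ((size Q)%:R <= K)%R & ((size T)%:R <= K)%R].

Definition form2 (K : R) (F : word X) : Prop :=
  exists A1 A2 xi1 xi2 : word X,
    [/\ F = A1 ++ inv_word A2,
        eqH A1 (inv_word xi1 ++ A2 ++ xi2),
        ((size xi1 + size xi2)%N%:R <= 12 * K)%R
      & conjugateH xi1 xi2].

Definition form3 (K : R) (F : word X) : Prop :=
  exists A1 B1 A2 B2 xi1 xi2 xi3 xi4 : word X,
    [/\ F = A1 ++ B1 ++ inv_word A2 ++ inv_word B2,
        eqH A1 (xi1 ++ A2 ++ xi3),
        eqH B1 (xi4 ++ B2 ++ xi2),
        ((size xi1 + size xi2 + size xi3 + size xi4)%N%:R <= 12 * K)%R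
      & eqH (xi1 ++ xi2 ++ xi3 ++ xi4) [::]].

Definition form4 (K : R) (F : word X) : Prop :=
  exists A1 B1 C1 A2 B2 C2 xi1 xi2 xi3 rho1 rho2 rho3 : word X,
    F = A1 ++ B1 ++ C1 ++ inv_word A2 ++ inv_word B2 ++ inv_word C2 /\
    [/\ eqH A1 (xi1 ++ A2 ++ rho1),
        eqH B1 (rho2 ++ B2 ++ xi2)
      & eqH C1 (xi3 ++ C2 ++ rho3)] /\
    ((size xi1 + size xi2 + size xi3 + size rho1 + size rho2 + size rho3)%N%:R
       <= 12 * K)%R /\
    eqH (xi1 ++ xi2 ++ xi3) [::] /\ eqH (rho1 ++ rho2 ++ rho3) [::].

End WordsInGroup.

(* Main.v *)
Require Import Defs.
From mathcomp Require Import all_boot all_order all_algebra.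
From mathcomp Require Import monoid finmap.
From mathcomp Require Import boolp classical_sets cardinality reals exp.
From mathcomp Require Import zify lra.

(* Write the conjugacy class of h as the boundary of a one-holed torus, that is
   h = g (P Q T P^-1 Q^-1 T^-1) g^-1, with |P| + |Q| + |T| minimal.  Folding two
   sides at a corner cannot shorten this hexagon, so all its corners have
   Gromov product at most about delta.  If the three sides are long, the hexagon
   is a broken geodesic which fellow travels with the geodesic F: form 4.  If T
   is short, collapsing it gives a nearly minimal h = g x y x^-1 y^-1 g^-1,
   whose corners are again small because folding one of them turns the
   commutator into a hexagon; if x and y are long this is form 3.  Otherwise y
   is short, and x is chosen of minimal length: then x^-1 and y x^-1 diverge
   after about M + |y| steps, since by the pigeonhole principle a long common
   part would contain a removable segment of x.  This is form 2, and it contains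
   form 1 (take A_1 empty), so form 1 is never needed.
   Finally g is chosen shortest among all such presentations of h.  Rotating the
   polygon moves g along the axis of h, so g ends close to the projection of 1
   to the axis, and 2|g| exceeds |h|_H by a constant only; when the polygon is
   short, the pigeonhole argument applies to g itself. *)

Set Implicit Arguments.
Unset Strict Implicit.
Unset Printing Implicit Defensive.

Import Order.TTheory GRing.Theory Num.Theory.

(** * Broken geodesics in a thin metric space *)

Record thin_metric (T : Type) (d : T -> T -> nat) (dl : nat) : Prop :=
  ThinMetric {
    distxx : forall x, d x x = 0;
    dist_sym : forall x y, d x y = d y x;
    dist_triangle : forall x y z, d x z <= d x y + d y z;
    dist_geodesic : forall x y t, t <= d x y ->
      exists2 z, d x z = t & t + d z y = d x y;
    dist_thin : forall p x y u v t,
      d p u = t -> t + d u x = d p x -> d p v = t -> t + d v y = d p y ->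
      2 * t + d x y <= d p x + d p y -> d u v <= dl }.

Section ThinMetric.
Variables (T : Type) (d : T -> T -> nat) (dl : nat).
Hypothesis dT : thin_metric d dl.
Local Notation E := (2 * dl + 1).

(* Throughout, Gromov products are doubled to stay in [nat]: the inequality
   [d x p + d p y <= d x y + k] says that the Gromov product of [x] and [y] at
   [p] is at most [k / 2].  [four_point] says that the smaller two of three
   doubled Gromov products at a point differ by at most [E]. *)
Lemma four_point p x y z :
  d p y + d x z <= maxn (d p x + d y z) (d p z + d x y) + E.
Proof.
have sym := dist_sym dT; have tri := dist_triangle dT.
(* [t] will be half of the smaller doubled product, rounded down; the three points at distance [t]
   from [p] are [dl]-close in turn, and the rounding costs the 1 in [E]. *)
pose m := minn (d p x + d p y - d x y) (d p y + d p z - d y z).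
have m2 : 2 * (m %/ 2) <= m by lia.
have m1 : m < 2 * (m %/ 2) + 2 by lia.
move: (m %/ 2) m2 m1; rewrite {}/m => t m2 m1.
have := (tri p x y, tri p y x, tri x p y, tri p y z, tri p z y, tri y p z).
rewrite (sym y x) (sym z y) (sym x p) (sym y p) => -[[[[[t1 t2] t3] t4] t5] t6].
have [|u pu ux] := dist_geodesic dT (x := p) (y := x) (t := t); first by lia.
have [|v pv vy] := dist_geodesic dT (x := p) (y := y) (t := t); first by lia.
have [|w pw wz] := dist_geodesic dT (x := p) (y := z) (t := t); first by lia.
have uv : d u v <= dl by apply: (dist_thin dT pu ux pv vy); lia.
have vw : d v w <= dl by apply: (dist_thin dT pv vy pw wz); lia.
have := (tri x u z, tri u w z, tri u v w); rewrite (sym x u) => -[[]].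
lia.
Qed.

(** [u] is compared with the point at distance [t] on a geodesic from [p] to [x], which is within
    [(k + 1) / 2] of [x]. The value of [t] is recorded so that successive cut points can be
    ordered. *)
Lemma close_to_geodesic p q x :
  exists2 t, 2 * t <= d p q + d p x - d x q < 2 * t + 2 /\ t <= d p q &
  forall u k, d p u = t -> t + d u q = d p q ->
    d p x + d x q <= d p q + k -> 2 * d u x <= 2 * dl + k + 1.
Proof.
have sym := dist_sym dT; have tri := dist_triangle dT.
have := (tri p x q, tri p q x, tri q p x); rewrite (sym q p) (sym q x).
move=> [[t1 t2] t3].
exists ((d p q + d p x - d x q) %/ 2); first by split; lia.
move: (_ %/ 2) (leq_divM (d p q + d p x - d x q) 2)
      (ltn_ceil (d p q + d p x - d x q) (isT : 0 < 2)) => t l1 l2 u k pu uq pxq.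
have [|v pv vx] := dist_geodesic dT (x := p) (y := x) (t := t); first by lia.
have uv : d u v <= dl.
  by apply: (dist_thin dT pu uq pv vx); rewrite (sym q x); lia.
by have := tri u v x; lia.
Qed.

(** At each vertex the product of [a] with the previous vertex is large because the edge is long, so
    [four_point] makes its product with the next vertex small. Hence the loss [E] does not
    accumulate. *)
Lemma chain_corners (c : nat -> T) n k a :
  (forall i, i.+1 < n ->
     d (c i) (c i.+1) + d (c i.+1) (c i.+2) <= d (c i) (c i.+2) + k) ->
  (forall i, i < n -> k + E < d (c i) (c i.+1)) ->
  d a (c 1) + d (c 1) (c 2) <= d a (c 2) + k + E ->
  forall i, 0 < i < n ->
    d a (c i) + d (c i) (c i.+1) <= d a (c i.+1) + k + E.
Proof.
have sym := dist_sym dT; move=> corner edge a12.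
elim=> // -[|i] IH //= lt_i.
have {}IH : d a (c i.+1) + d (c i.+1) (c i.+2) <= d a (c i.+2) + k + E.
  by apply: IH; lia.
have := corner i.+1 lt_i; have := edge i.+1 (ltnW lt_i).
have := four_point (c i.+2) (c i.+1) a (c i.+3).
rewrite !(sym (c i.+2) a) !(sym (c i.+2) (c i.+1)) !(sym (c i.+1) a).
lia.
Qed.

(** The backward estimate is the forward one on the reversed chain. At [c i], the product of
    [c i.+1] with [b] is large and that with [a] is small, so the product of [a] and [b] is
    small. *)
Lemma chain_near (c : nat -> T) n k a b :
  (forall i, i.+1 < n ->
     d (c i) (c i.+1) + d (c i.+1) (c i.+2) <= d (c i) (c i.+2) + k) ->
  (forall i, i < n -> 2 * k + 3 * E < 2 * d (c i) (c i.+1)) ->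
  d a (c 1) + d (c 1) (c 2) <= d a (c 2) + k + E ->
  d b (c n.-1) + d (c n.-1) (c n.-2) <= d b (c n.-2) + k + E ->
  [/\ forall i, 0 < i < n ->
        d a (c i) + d (c i) (c i.+1) <= d a (c i.+1) + k + E,
      forall i, 0 < i < n ->
        d b (c i) + d (c i) (c i.-1) <= d b (c i.-1) + k + E
    & forall i, 0 < i < n.-1 -> d a (c i) + d (c i) b <= d a b + k + 2 * E].
Proof.
have sym := dist_sym dT; move=> corner edge a12 bn.
have fwd := chain_corners corner _ a12.
have {}fwd i : 0 < i < n ->
    d a (c i) + d (c i) (c i.+1) <= d a (c i.+1) + k + E.
  by apply: fwd => {}i /edge; lia.
have bwd i : 0 < i < n ->
    d b (c i) + d (c i) (c i.-1) <= d b (c i.-1) + k + E.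
  move=> lt_i.
  have := @chain_corners (fun j => c (n - j)) n k b _ _ _ (n - i).
  rewrite (_ : n - (n - i) = i); last by lia.
  rewrite (_ : n - (n - i).+1 = i.-1); last by lia.
  apply; last by lia.
  - move=> j lt_j /=; have := corner (n - j.+2).
    rewrite (_ : (n - j.+2).+1 = n - j.+1); last by lia.
    rewrite (_ : (n - j.+1).+1 = n - j); last by lia.
    rewrite !(sym (c (n - j))) (sym (c (n - j.+1)) (c (n - j.+2))).
    lia.
  - move=> j lt_j /=; have := edge (n - j.+1).
    rewrite (_ : (n - j.+1).+1 = n - j); last by lia.
    rewrite (sym (c (n - j))); lia.
  - by rewrite !subn1 subn2.
split=> // i lt_i.
have /= := bwd i.+1; have := fwd i; have := edge i.
have := four_point (c i) (c i.+1) b a.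
rewrite (sym (c i) a) (sym (c i.+1) (c i)) (sym b (c i.+1)) (sym b (c i)).
rewrite (sym (c i.+1) a) (sym b a).
lia.
Qed.

Corollary broken_geodesic (c : nat -> T) n k :
  (forall i, i.+1 < n ->
     d (c i) (c i.+1) + d (c i.+1) (c i.+2) <= d (c i) (c i.+2) + k) ->
  (forall i, i < n -> 2 * k + 3 * E < 2 * d (c i) (c i.+1)) ->
  forall i, i < n ->
    [/\ d (c 0) (c i) + d (c i) (c n) <= d (c 0) (c n) + k + 2 * E,
        d (c 0) (c i) <= d (c 0) (c i.+1) & d (c i.+1) (c n) <= d (c i) (c n)].
Proof.
have sym := dist_sym dT; have xx := distxx dT => corner edge.
case: n => [|[|n]] in corner edge * => [//|[]//|]; first by rewrite !xx;
  split; lia.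
have [||fwd bwd near] := chain_near (a := c 0) (b := c n.+2) corner edge.
- by have := corner 0 isT; lia.
- have := corner n (leqnn _); rewrite /= (sym (c n.+2) (c n.+1)).
  by rewrite (sym (c n.+1) (c n)) (sym (c n.+2) (c n)); lia.
move=> i lt_i; split.
- case: i lt_i => [|i] lt_i; first by rewrite xx; lia.
  have [|le_n] := ltnP i.+1 n.+1; first by move=> lt; apply: near; lia.
  by have := fwd i.+1; rewrite (_ : i.+2 = n.+2); lia.
- case: i lt_i => [|i] lt_i; first by rewrite xx; lia.
  by have := fwd i.+1; have := edge i.+1; lia.
- have [|le_n] := ltnP i.+1 n.+2; last by rewrite (_ : i.+1 = n.+2) ?xx; lia.
  by have /= := bwd i.+1; have := edge i;
    rewrite !(sym _ (c n.+2)) (sym (c i.+1)); lia.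
Qed.

(** The product of [a] and [c0] at [c1] is at least half the edge from [c0] to [c1], so [four_point]
    bounds the product of [a] and [c2]. *)
Lemma turn_away a c0 c1 c2 k :
  d c0 c1 + d c1 c2 <= d c0 c2 + k -> k + E < d c0 c1 -> d a c0 <= d a c1 ->
  d a c1 + d c1 c2 <= d a c2 + k + E.
Proof.
have sym := dist_sym dT; have := four_point c1 c0 a c2.
rewrite (sym c1 a) (sym c1 c0) (sym c0 a); lia.
Qed.

(** The product of [a] and [b] at [c 1] is small, and [c 1] is at least as far from [a] as [c 0]
    and, walking back along the chain, at least as far from [b] as [c n]. *)
Lemma broken_geodesic_ends (c : nat -> T) n k a b :
  2 < n ->
  (forall i, i.+1 < n ->
     d (c i) (c i.+1) + d (c i.+1) (c i.+2) <= d (c i) (c i.+2) + k) ->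
  (forall i, i < n -> 2 * k + 3 * E < 2 * d (c i) (c i.+1)) ->
  d a (c 0) <= d a (c 1) -> d b (c n) <= d b (c n.-1) ->
  d a (c 0) + d b (c n) <= d a b + k + 2 * E.
Proof.
have sym := dist_sym dT; case: n => [|[|[|n]]] // _ corner edge a0 bn.
have [||fwd bwd near] := chain_near (a := a) (b := b) corner edge.
- by apply: turn_away (corner 0 isT) _ a0; have := edge 0 isT; lia.
- rewrite /= in bn *; apply: (@turn_away _ (c n.+3)) bn.
    have := corner n.+1 (leqnn _); rewrite (sym (c n.+3) (c n.+2)).
    by rewrite (sym (c n.+2) (c n.+1)) (sym (c n.+3) (c n.+1)); lia.
  by have := edge n.+2 (leqnn _); rewrite (sym (c n.+3)); lia.
have dec i : i < n.+2 -> d b (c n.+2) <= d b (c (n.+2 - i)).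
  elim: i => [|i IH] lt_i; first by rewrite subn0.
  have := bwd (n.+2 - i); have := edge (n.+2 - i.+1); have := IH (ltnW lt_i).
  rewrite (_ : (n.+2 - i).-1 = n.+2 - i.+1); last by lia.
  rewrite (_ : (n.+2 - i.+1).+1 = n.+2 - i) ?(sym (c (n.+2 - i))); lia.
have := near 1 isT; have := dec n.+1 (leqnn _); rewrite (_ : n.+2 - n.+1 = 1);
  last by lia.
by rewrite /= (sym _ b) in bn *; lia.
Qed.

(** The analogue of [broken_geodesic_ends] for two edges, used when one side of the commutator is
    short. *)
Lemma corner_ends a b c0 c1 c2 k :
  d c0 c1 + d c1 c2 <= d c0 c2 + k ->
  k + 2 * E < d c0 c1 -> k + 2 * E < d c1 c2 ->
  d a c0 <= d a c1 -> d b c2 <= d b c1 ->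
  d a c0 + d b c2 <= d a b + k + 2 * E.
Proof.
have sym := dist_sym dT => corner e0 e1 a0 b2.
have := turn_away corner _ a0; have := four_point c1 c2 b a.
rewrite (sym c1 b) (sym c2 a) (sym c1 a) (sym b a) (sym c2 b); lia.
Qed.

End ThinMetric.

(** * Minimal hexagons and commutators *)

Ltac reduce_group :=
  rewrite ?(invgM, invgK, invg1, mulg1, mul1g, mulgA, mulgV, mulVg, mulgK,
    mulgVK).

(* Canonical structure inference produces several convertible paths from a
   group to its underlying magma, which [lia] would treat as distinct. *)
Ltac group_lia H :=
  let G' := constr:(monoid_Group__to__monoid_Magma H) in
  let B' := constr:(monoid_Group__to__monoid_BaseGroup H) in
  repeat match goal with
  | |- context [@mul ?G _ _] =>
      tryif constr_eq G G' then fail else change G with G' in *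
  | _ : context [@mul ?G _ _] |- _ =>
      tryif constr_eq G G' then fail else change G with G' in *
  | |- context [@inv ?G _] =>
      tryif constr_eq G B' then fail else change G with B' in *
  | _ : context [@inv ?G _] |- _ =>
      tryif constr_eq G B' then fail else change G with B' in *
  end; lia.

Lemma exists_minimizer (A : Type) (P : A -> Prop) (f : A -> nat) :
  (exists x, P x) -> exists2 x, P x & forall y, P y -> f x <= f y.
Proof.
move=> [x0 Px0].
have exn : exists n, `[< exists2 x, P x & f x = n >].
  by exists (f x0); apply/asboolP; exists x0.
case: (ex_minnP exn) => n /asboolP[x Px <-] min.
by exists x => // y Py; apply: min; apply/asboolP; exists y.
Qed.

Section Metric.
Local Open Scope group_scope.
Variables (H : groupType) (len : H -> nat) (dl M : nat).
Local Notation d := (fun x y => len (x^-1 * y)).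
Local Notation E := (2 * dl + 1)%N.
Hypothesis dT : thin_metric d dl.
Hypothesis ballM : forall n (f : nat -> H),
  (forall i, i < n -> len (f i) <= 4 * dl)%N ->
  (forall i j, i < j < n -> f i <> f j)%N -> (n <= M)%N.

Lemma len1 : len 1 = 0%N.
Proof. by have := distxx dT 1; rewrite mulVg. Qed.

Lemma lenV x : len x^-1 = len x.
Proof. by have := dist_sym dT x 1; rewrite mulg1 invg1 mul1g. Qed.

Lemma lenM x y : (len (x * y) <= len x + len y)%N.
Proof. by have := dist_triangle dT x^-1 1 y; reduce_group. Qed.

Lemma len_divl x y : (len x <= len (x * y) + len y)%N.
Proof. by have := lenM (x * y) y^-1; rewrite mulgK lenV. Qed.

Lemma dist_left g x y : d (g * x) (g * y) = d x y.
Proof. by congr len; reduce_group. Qed.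

(** [s] lies on a geodesic from 1 to [a], at distance the rounded Gromov product of [a] and [b],
    hence within [dl] of a geodesic from 1 to [b]. *)
Lemma tripod_fold a b :
  exists s, [/\ len (s^-1 * a) + len s = len a,
    len (s^-1 * b) + len s <= len b + dl
    & len a + len b <= len (a^-1 * b) + 2 * len s + 1]%N.
Proof.
have := lenM a^-1 b; have := lenM a (a^-1 * b); have := lenM b (b^-1 * a).
rewrite !mulVKg lenV (dist_sym dT b) => t1 t2 t3.
have [t t4 t5] : exists2 t, (2 * t <= len a + len b - len (a^-1 * b))%N
    & (len a + len b - len (a^-1 * b) <= 2 * t + 1)%N.
  by exists ((len a + len b - len (a^-1 * b)) %/ 2)%N; group_lia H.
have [|u /= u1 ua] := dist_geodesic dT (x := 1) (y := a) (t := t).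
  by rewrite /=; reduce_group; group_lia H.
have [|v /= v1 vb] := dist_geodesic dT (x := 1) (y := b) (t := t).
  by rewrite /=; reduce_group; group_lia H.
have /= := dist_thin dT u1 ua v1 vb; have /= := dist_triangle dT u v b.
move: u1 v1 ua vb; reduce_group => u1 v1 ua vb tri uv.
by exists u; rewrite u1; split; group_lia H.
Qed.

Lemma ball_gt0 : (0 < M)%N.
Proof.
by apply: (ballM (f := fun=> 1)) => [i _|[|i] [|j]];
  rewrite ?len1 // !ltnS ltn0 andbF.
Qed.

(* The lengths of [y u] and [u] differ by at most [2 dl] because [u] is not
   longer than [y^-1 u], so the points at distance [i] correspond. *)
Lemma conj_fellow_travel y u i :
  (len u <= len (y * u))%N -> (len u <= len (y^-1 * u))%N ->
  (2 * i + len (u^-1 * y * u) <= len u + len (y * u))%N ->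
  (len (y * u) + len y <= 2 * i + len u)%N ->
  (len (y * u) <= len u + 2 * dl)%N /\
  exists p, [/\ len p = i, i + len (p^-1 * u) = len u
    & len (p^-1 * y * p) <= 4 * dl]%N.
Proof.
move=> le_u le_uV le_i ge_i.
have := lenM u (u^-1 * (y * u)); have := lenM y u.
rewrite mulVKg mulgA => t1 t2.
have [|p /= p1 pu] := dist_geodesic dT (x := 1) (y := u) (t := i).
  by rewrite /=; reduce_group; group_lia H.
have [|w /= w1 wz] := dist_geodesic dT (x := 1) (y := y * u) (t := i).
  by rewrite /=; reduce_group; group_lia H.
move: p1 pu w1 wz; reduce_group => p1 pu w1 wz.
(* [q] is chosen so that [y * q] and [w] are equally far from [y * u]. Thinness at 1 and at [y * u]
   then links [p], [w] and [y * q]. *)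
have [|q /= q1 qp] := dist_geodesic dT (x := 1) (y := p)
                        (t := (i - (len (y * u) - len u))%N).
  by rewrite /=; reduce_group; group_lia H.
have := dist_triangle dT q p u; have := lenM q (q^-1 * u).
move: q1 qp; rewrite /= mulVKg; reduce_group => q1 qp t3 t4.
have pw : (len (p^-1 * w) <= dl)%N.
  by apply: (dist_thin dT (p := 1) (x := u) (y := y * u) (t := i)) => /=;
    reduce_group; group_lia H.
have wq : (len (w^-1 * (y * q)) <= dl)%N.
  apply: (dist_thin dT (p := y * u) (x := 1) (y := y)
                      (t := (len (y * u) - i)%N)) => /=.
  - by rewrite (dist_sym dT); reduce_group; group_lia H.
  - by rewrite !mulg1 !lenV; group_lia H.
  - by rewrite dist_left (dist_sym dT) /=; group_lia H.
  - rewrite (dist_sym dT (y * q)) -[y in len (y^-1 * _)]mulg1 dist_left invg1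
    mul1g.
    rewrite (dist_sym dT (y * u)) -[y in (y^-1 * _)]mulg1 dist_left invg1 mul1g.
    group_lia H.
  - by rewrite mulg1 lenV (dist_sym dT (y * u) y) /= mulKg invg1 mul1g;
    group_lia H.
have := lenM (p^-1 * w) (w^-1 * (y * q)); have := lenM q (p^-1 * y * q)^-1.
have := lenM (y^-1 * p) (p^-1 * u); have := lenM (p^-1 * y * q) (q^-1 * p).
rewrite lenV; move: wq; reduce_group => wq t5 t6 t7 t8.
split; first by group_lia H.
by exists p; split; group_lia H.
Qed.

(* Two points of the geodesic from [1] to [u] that [y] displaces by the same
   element allow to cut out the segment between them. *)
Lemma conj_pigeonhole y u :
  (forall v, v^-1 * y * v = u^-1 * y * u -> (len u <= len v)%N) ->
  (len u + len (y * u) <= len (u^-1 * y * u) + 2 * M + len y + 2 * dl)%N.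
Proof.
move=> min.
have le_u : (len u <= len (y * u))%N by apply: min; reduce_group.
have le_uV : (len u <= len (y^-1 * u))%N by apply: min; reduce_group.
have := lenM u^-1 (y * u); rewrite lenV mulgA => le_D.
(* [lo] and [hi] delimit the [i] allowed by the last two hypotheses of [conj_fellow_travel]. *)
pose lo := ((len (y * u) + len y + 1 - len u) %/ 2)%N.
pose hi := ((len u + len (y * u) - len (u^-1 * y * u)) %/ 2)%N.
have travel : forall i, (lo <= i <= hi)%N ->
    (len (y * u) <= len u + 2 * dl)%N /\
    exists p, [/\ len p = i, i + len (p^-1 * u) = len u
    & len (p^-1 * y * p) <= 4 * dl]%N.
  by rewrite /lo /hi => i lt_i; apply: conj_fellow_travel; group_lia H.
have /choice[f fP] : forall i, exists p, (i < hi.+1 - lo)%N ->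
    [/\ len p = lo + i, lo + i + len (p^-1 * u) = len u
    & len (p^-1 * y * p) <= 4 * dl]%N.
  move=> i; have [lt_i|le_i] := ltnP i (hi.+1 - lo); last by exists 1.
  by have [|_ [p pP]] := travel (lo + i)%N; [group_lia H | exists p].
have M_gt0 := ball_gt0.
have leM : (hi.+1 - lo <= M)%N.
  apply: (ballM (f := fun i => (f i)^-1 * y * f i)) => [i /fP[] //|i j lt_ij
    eq_ij].
  have [|fi iu _] := fP i; first by group_lia H.
  have [|fj ju _] := fP j; first by group_lia H.
  have /min : (f i * (f j)^-1 * u)^-1 * y * (f i * (f j)^-1 * u) = u^-1 * y * u.
    have -> : (f i * (f j)^-1 * u)^-1 * y * (f i * (f j)^-1 * u) =
       u^-1 * f j * ((f i)^-1 * y * f i) * (f j)^-1 * u by reduce_group.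
    by rewrite eq_ij; reduce_group.
  have := lenM (f i) ((f j)^-1 * u); rewrite mulgA; group_lia H.
(* This settles an empty range, where [2 * len u <= len (u^-1 * y * u) + len y]; the 1 in [E] is
   absorbed by [M_gt0]. *)
have := four_point dT 1 y (y * u) u; rewrite /= invg1 !mul1g mulKg.
rewrite (dist_sym dT (y * u)) /= mulgA => hyp.
have [le_hi|lt_hi] := leqP lo hi; last by rewrite /lo /hi in lt_hi; group_lia H.
have [|le_yu _] := travel lo; first by rewrite leqnn.
by rewrite /lo /hi in leM le_hi; group_lia H.
Qed.

(** * Boundary words of the one-holed torus *)

Definition hexagon (P Q T : H) := P * Q * T * P^-1 * Q^-1 * T^-1.
Definition quad (x y : H) := x * y * x^-1 * y^-1.

(** Rotation keeps the side lengths: every corner becomes a first corner, and a shortest [g]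
    satisfies [len g <= len (g * P)]. *)
Lemma hexagon_rotate h g P Q T :
  h * g = g * hexagon P Q T -> h * (g * P) = g * P * hexagon Q T P^-1.
Proof. by move=> hg; rewrite mulgA hg /hexagon; reduce_group. Qed.

Lemma quad_rotate h g x y :
  h * g = g * quad x y -> h * (g * x) = g * x * quad y x^-1.
Proof. by move=> hg; rewrite mulgA hg /quad; reduce_group. Qed.

Lemma hexagon_rotateV h g P Q T :
  h * g = g * hexagon P Q T -> h * (g * T) = g * T * hexagon T^-1 P Q.
Proof. by move=> hg; rewrite mulgA hg /hexagon; reduce_group. Qed.

Lemma quad_rotateV h g x y :
  h * g = g * quad x y -> h * (g * y) = g * y * quad y^-1 x.
Proof. by move=> hg; rewrite mulgA hg /quad; reduce_group. Qed.

(** [T] is absorbed by both neighbours, which raises the total length by at most [len T]. *)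
Lemma hexagon_collapse P Q T : hexagon P Q T = quad (P * T^-1) (T * Q).
Proof. by rewrite /hexagon /quad; reduce_group. Qed.

Section NearMinimal.
Variables (h : H) (m r : nat).
Hypothesis min_m : forall g P Q T,
  h * g = g * hexagon P Q T -> (m <= len P + len Q + len T)%N.

(** Folding along [s] takes [len s] off two sides, up to [dl], and adds at most [len s] to the
    third, so [min_m] gives [len s <= dl + r]. *)
Lemma hexagon_corner g P Q T :
  h * g = g * hexagon P Q T -> (len P + len Q + len T <= m + r)%N ->
  (len P + len Q <= len (P * Q) + 2 * (dl + r) + 1)%N.
Proof.
move=> hg le_m; have [s []] := tripod_fold P^-1 Q;
  rewrite invgK lenV => sP sQ PQ.
have /min_m : h * g = g * hexagon (P * s) (s^-1 * Q) (T * s).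
  by rewrite hg /hexagon; reduce_group.
have := lenM T s; have := lenV (P * s); rewrite invgM.
group_lia H.
Qed.

(* Folding [x^-1] and [y] along [s] turns the commutator into a hexagon with
   [s] as third side. *)
Lemma quad_corner g x y :
  h * g = g * quad x y -> (len x + len y <= m + r)%N ->
  (len x + len y <= len (x * y) + 2 * (dl + r) + 1)%N.
Proof.
move=> hg le_m; have [s []] := tripod_fold x^-1 y;
  rewrite invgK lenV => sx sy xy.
have /min_m : h * g = g * hexagon (x * s) (s^-1 * y) s.
  by rewrite hg /hexagon /quad; reduce_group.
have := lenV (x * s); rewrite invgM.
group_lia H.
Qed.

End NearMinimal.

(** * Long polygons as broken geodesics *)

Definition hexagon_path P Q T (i : nat) : H :=
  nth (hexagon P Q T) [:: 1; P; P * Q; P * Q * T; P * Q * T * P^-1;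
    P * Q * T * P^-1 * Q^-1] i.

(** In both paths the default value of [nth] supplies the final vertex. *)
Definition quad_path x y (i : nat) : H :=
  nth (quad x y) [:: 1; x; x * y; x * y * x^-1] i.

(** [g^-1] and [g^-1 * h] are [len h] apart and each at distance [len g] from its end of the
    path. *)
Lemma path_ends (c : nat -> H) n k h g :
  (2 < n)%N -> c 0 = 1 -> h * g = g * c n ->
  (forall i, i.+1 < n ->
     d (c i) (c i.+1) + d (c i.+1) (c i.+2) <= d (c i) (c i.+2) + k)%N ->
  (forall i, i < n -> 2 * k + 3 * E < 2 * d (c i) (c i.+1))%N ->
  (len g <= len (g * c 1%N))%N -> (len g <= len (g * (c n)^-1 * c n.-1))%N ->
  (2 * len g <= len h + k + 2 * E)%N.
Proof.
move=> n_gt2 c0 hg corner edge g1 gn.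
have hE : h = g * c n * g^-1 by rewrite -hg mulgK.
have := broken_geodesic_ends dT (a := g^-1) (b := g^-1 * h) n_gt2 corner edge.
rewrite /= c0 hE; reduce_group.
by move=> /(_ g1 gn); group_lia H.
Qed.

(** The two monotonicity conditions will order the cut points on [F]. *)
Definition passes_near (c : nat -> H) n k := forall i, (i < n)%N ->
  [/\ d (c 0) (c i) + d (c i) (c n) <= d (c 0) (c n) + k,
      d (c 0) (c i) <= d (c 0) (c i.+1) & d (c i.+1) (c n) <= d (c i) (c n)]%N.

Lemma long_hexagon h g P Q T :
  h * g = g * hexagon P Q T ->
  (forall g' P' Q' T', h * g' = g' * hexagon P' Q' T' ->
     (len P + len Q + len T <= len P' + len Q' + len T')%N) ->
  (5 * E < 2 * len P)%N -> (5 * E < 2 * len Q)%N -> (5 * E < 2 * len T)%N ->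
  passes_near (hexagon_path P Q T) 6 (3 * E) /\
  ((len g <= len (g * P))%N -> (len g <= len (g * T))%N ->
   (2 * len g <= len h + 3 * E)%N).
Proof.
move=> hg min_m lP lQ lT.
have corner g' P' Q' T' : h * g' = g' * hexagon P' Q' T' ->
    (len P' + len Q' + len T' <= len P + len Q + len T)%N ->
    (len P' + len Q' <= len (P' * Q') + E)%N.
  by move=> hg' le_sum; have := hexagon_corner min_m (r := 0) hg'; group_lia H.
have hg1 := hexagon_rotate hg; have hg2 := hexagon_rotate hg1.
have hg3 := hexagon_rotate hg2; have hg4 := hexagon_rotate hg3.
(* Corner [i] is the first corner of the [i]-th rotation. *)
have corners i : (i.+1 < 6)%N -> let c := hexagon_path P Q T in
    (d (c i) (c i.+1) + d (c i.+1) (c i.+2) <= d (c i) (c i.+2) + E)%N.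
  case: i => [|[|[|[|[|i]]]]] // _; rewrite /hexagon_path /= /hexagon;
    reduce_group.
  - by apply: corner hg _.
  - by apply: corner hg1 _; rewrite !lenV; group_lia H.
  - by apply: corner hg2 _; rewrite !lenV; group_lia H.
  - by apply: corner hg3 _; rewrite !lenV; group_lia H.
  - by apply: corner hg4 _; rewrite !lenV; group_lia H.
have edges i : (i < 6)%N -> let c := hexagon_path P Q T in
    (2 * E + 3 * E < 2 * d (c i) (c i.+1))%N.
  by case: i => [|[|[|[|[|[|i]]]]]] // _; rewrite /hexagon_path /= /hexagon;
    reduce_group;
    rewrite ?lenV; group_lia H.
split=> [i lt_i|g1 gT].
  by have [near mono1 mono2] := broken_geodesic dT corners edges lt_i; split;
    group_lia H.
have := path_ends (c := hexagon_path P Q T) (n := 6) (k := E) isT erefl hg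
  corners edges.
rewrite /hexagon_path /= /hexagon; move: gT g1;
  reduce_group => gT g1 /(_ g1 gT); group_lia H.
Qed.

Lemma long_quad h g x y m r k :
  h * g = g * quad x y ->
  (forall g' P' Q' T', h * g' = g' * hexagon P' Q' T' ->
     (m <= len P' + len Q' + len T')%N) ->
  (len x + len y <= m + r)%N -> k = (2 * (dl + r) + 1)%N ->
  (2 * k + 3 * E < 2 * len x)%N -> (2 * k + 3 * E < 2 * len y)%N ->
  passes_near (quad_path x y) 4 (k + 2 * E) /\
  ((len g <= len (g * x))%N -> (len g <= len (g * y))%N ->
   (2 * len g <= len h + k + 2 * E)%N).
Proof.
move=> hg min_m le_m kE lx ly.
have hg1 := quad_rotate hg; have hg2 := quad_rotate hg1.
have corners i : (i.+1 < 4)%N -> let c := quad_path x y in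
    (d (c i) (c i.+1) + d (c i.+1) (c i.+2) <= d (c i) (c i.+2) + k)%N.
  case: i => [|[|[|i]]] // _; rewrite /quad_path /= /quad kE; reduce_group.
  - by have := quad_corner min_m hg le_m; group_lia H.
  - by have := quad_corner (r := r) min_m hg1; rewrite !lenV; group_lia H.
  - by have := quad_corner (r := r) min_m hg2; rewrite !lenV; group_lia H.
have edges i : (i < 4)%N -> let c := quad_path x y in
    (2 * k + 3 * E < 2 * d (c i) (c i.+1))%N.
  by case: i => [|[|[|[|i]]]] // _; rewrite /quad_path /= /quad; reduce_group;
    rewrite ?lenV; group_lia H.
split=> [i lt_i|g1 gy].
  by have [near mono1 mono2] := broken_geodesic dT corners edges lt_i; split;
    group_lia H.
have := path_ends (c := quad_path x y) (n := 4) (k := k) isT erefl hg corners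
  edges.
rewrite /quad_path /= /quad; move: gy g1; reduce_group => gy g1 /(_ g1 gy);
  group_lia H.
Qed.

(** * Commutators with a short side *)

Lemma short_quad_corner h g x y :
  h * g = g * quad x y ->
  (forall g' x', h * g' = g' * quad x' y -> (len x <= len x')%N) ->
  (len x + len (y * x^-1) <= len (x * y * x^-1) + 2 * M + len y + 2 * dl)%N /\
  (len (x * y) + len x <= len (x * y * x^-1) + 2 * M + len y + 2 * dl)%N.
Proof.
move=> hg min_x.
(* For fixed [y] the commutator depends only on [x * y * x^-1], so [conj_pigeonhole] applies to
   [u = x^-1], with [y] and then with [y^-1]. *)
have min_V v : v^-1 * y * v = x * y * x^-1 -> (len x^-1 <= len v)%N.
  rewrite lenV -(lenV v) => eq_v; apply: (min_x g).
  by rewrite hg /quad invgK -eq_v.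
split; first by have := @conj_pigeonhole y x^-1; rewrite invgK => /(_ min_V);
  rewrite lenV.
have min_V' v : v^-1 * y^-1 * v = x^-1^-1 * y^-1 * x^-1 -> (len x^-1 <= len
  v)%N.
  by move=> eq_v; apply: min_V; apply: invg_inj; move: eq_v; reduce_group.
have conjV : len (x * y^-1 * x^-1) = len (x * y * x^-1).
  by rewrite -lenV; reduce_group.
by have := conj_pigeonhole min_V'; rewrite invgK -invgM !lenV conjV;
  group_lia H.
Qed.

(** [conj_pigeonhole] is applied to [u = g^-1]. As [F] commutes with itself, [g * F^-1] also
    conjugates, whence [len g <= len (F * g^-1)]. *)
Lemma conjugator_bound h g F :
  h * g = g * F -> (forall g', h * g' = g' * F -> (len g <= len g')%N) ->
  (2 * len g <= len h + 2 * M + len F + 2 * dl)%N.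
Proof.
move=> hg min_g.
have hE : h = g * F * g^-1 by rewrite -hg mulgK.
have := @conj_pigeonhole F g^-1; rewrite invgK lenV -hE.
have : (len g <= len (F * g^-1))%N.
  by rewrite -(lenV (F * _)) invgM invgK; apply: min_g; rewrite mulgA hg;
    reduce_group.
have min_V v : v^-1 * F * v = h -> (len g <= len v)%N.
  by move=> eq_v; rewrite -(lenV v); apply: min_g; rewrite -eq_v; reduce_group.
by move=> le_g /(_ min_V); group_lia H.
Qed.

Lemma short_quad h g x y Y k :
  h * g = g * quad x y -> (len y <= Y)%N ->
  (forall g' x' y', h * g' = g' * quad x' y' -> (len y' <= Y)%N ->
     (len x <= len x')%N) ->
  (forall g' x' y', h * g' = g' * quad x' y' -> (len y' <= Y)%N ->
     (len x' <= len x)%N -> (len g <= len g')%N) ->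
  k = (2 * M + 3 * Y + 2 * dl)%N ->
  (len x + len (y * x^-1 * y^-1) <= len (quad x y) + k)%N /\
  (2 * len g <= len h + 4 * Y + 2 * k + 4 * E + 2 * M + 2 * dl)%N.
Proof.
move=> hg le_y min_x min_g ->.
have [|cor1 cor2] := short_quad_corner hg.
  by move=> g' x' /min_x; apply.
have t1 := lenM (y * x^-1) y^-1; have t2 := len_divl (x * y * x^-1) y^-1.
have t3 := lenM x^-1 y^-1; have t4 := len_divl x y;
  have t5 := len_divl x^-1 y^-1.
have t6 : (len (quad x y) <= len x + len y + len x + len y)%N.
  have := lenM (x * y * x^-1) y^-1; have := lenM (x * y) x^-1; have := lenM x y.
  by rewrite /quad !lenV; group_lia H.
rewrite !lenV in t1 t2 t3 t5; split; first by rewrite /quad; group_lia H.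
(* If [x] is short, so is the commutator, and [conjugator_bound] suffices. Otherwise the path
   through 1, [x * y] and [quad x y] has two long edges. *)
have [le_x|lt_x] := leqP (len x) (Y + (2 * M + 3 * Y + 2 * dl) + 2 * E).
  have := conjugator_bound hg; have min_g' g' : h * g' = g' * quad x y -> (len
    g <= len g')%N.
    by move=> hg'; apply: min_g hg' le_y _.
  by move=> /(_ min_g'); group_lia H.
have hg2 := quad_rotate (quad_rotate hg).
have hE : h = g * quad x y * g^-1 by rewrite -hg mulgK.
have g2 : (len g <= len (g * x * y))%N by apply: min_g hg2 _ _; rewrite lenV.
(* [h^-1] commutes with [h], so it carries the twice rotated presentation to another one. *)
have g2' : (len g <= len (h^-1 * (g * x * y)))%N.
  apply: min_g (x^-1) (y^-1) _ _ _; rewrite ?lenV //.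
  by rewrite -[RHS]mulgA -hg2; reduce_group.
have := corner_ends dT (a := g^-1) (b := g^-1 * h) (c0 := 1) (c1 := x * y)
  (c2 := quad x y) (k := 2 * M + 3 * Y + 2 * dl).
move: g2 g2'; rewrite hE /quad /=; reduce_group => g2 g2' near.
by rewrite /quad in t2 t6; group_lia H.
Qed.

(* A side [T] of a minimal hexagon is short when [2 |T| <= 5 E], that is
   [|T| <= 5 dl + 2].  Collapsing it gives corners [k = 2 (dl + 5 dl + 2) + 1],
   and [15 dl + 6] is the integer part of [(2 k + 3 E) / 2], the length beyond
   which [broken_geodesic] applies. *)
Theorem commutator_conjugate h x0 y0 : h = quad x0 y0 ->
  exists2 g, (2 * len g <= len h + 358 * dl + 16 * M + 56)%N &
  [\/ exists P Q T, h * g = g * hexagon P Q T /\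
         passes_near (hexagon_path P Q T) 6 (3 * E),
      exists x y, h * g = g * quad x y /\
         passes_near (quad_path x y) 4 (16 * dl + 7)
    | exists x y, [/\ h * g = g * quad x y, (len y <= 15 * dl + 6)%N
         & (len x + len (y * x^-1 * y^-1) <= len (quad x y) + 2 * M + 47 * dl +
           18)%N]].
Proof.
move=> h0; have M_gt0 := ball_gt0.
have [|[[[g0 P0] Q0] T0] /= hg0 min_sum] := @exists_minimizer _
  (fun c : H * H * H * H => h * c.1.1.1 = c.1.1.1 * hexagon c.1.1.2 c.1.2 c.2)
  (fun c => len c.1.1.2 + len c.1.2 + len c.2)%N.
  by exists (1, x0, y0, 1) => /=; rewrite h0 /quad /hexagon; reduce_group.
have {}min_sum g P Q T : h * g = g * hexagon P Q T ->
    (len P0 + len Q0 + len T0 <= len P + len Q + len T)%N.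
  by move=> hg; apply: (min_sum (g, P, Q, T)).
have [m le_m min_m] : exists2 m, (len P0 + len Q0 + len T0 <= m)%N &
    forall g P Q T, h * g = g * hexagon P Q T -> (m <= len P + len Q + len T)%N.
  by exists (len P0 + len Q0 + len T0)%N.
have [|[[[g P] Q] T] /= [hg le_PQT] min_g] := @exists_minimizer _
  (fun c : H * H * H * H => h * c.1.1.1 = c.1.1.1 * hexagon c.1.1.2 c.1.2 c.2 /\
     (len c.1.1.2 + len c.1.2 + len c.2 <= m)%N) (fun c => len c.1.1.1).
  by exists (g0, P0, Q0, T0).
have {}min_g g' P' Q' T' : h * g' = g' * hexagon P' Q' T' ->
    (len P' + len Q' + len T' <= m)%N -> (len g <= len g')%N.
  by move=> hg' le_m'; apply: (min_g (g', P', Q', T')).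
have hg1 := hexagon_rotate hg; have hg2 := hexagon_rotate hg1.
(* A rotation brings any short side into third place. *)
pose short := exists g' P' Q' T', [/\ h * g' = g' * hexagon P' Q' T',
  (len P' + len Q' + len T' <= m)%N & (2 * len T' <= 5 * E)%N].
have [[lP lQ lT]|] : [/\ 5 * E < 2 * len P, 5 * E < 2 * len Q
    & 5 * E < 2 * len T]%N \/ short.
- have [sP|lP] := leqP (2 * len P) (5 * E).
    by right; do 4!eexists; split; [exact: hg1| |]; rewrite lenV; group_lia H.
  have [sQ|lQ] := leqP (2 * len Q) (5 * E).
    by right; do 4!eexists; split; [exact: hg2| |]; rewrite !lenV; group_lia H.
  have [sT|lT] := leqP (2 * len T) (5 * E); last by left.
  by right; exists g, P, Q, T.
- have [|near bound] := long_hexagon hg _ lP lQ lT.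
    by move=> g' P' Q' T' /min_m; apply: leq_trans.
  exists g; last by apply: Or31; exists P, Q, T.
  have gP : (len g <= len (g * P))%N by apply: min_g hg1 _; rewrite lenV;
    group_lia H.
  have gT : (len g <= len (g * T))%N.
    by apply: min_g (hexagon_rotateV hg) _; rewrite lenV; group_lia H.
  by have := bound gP gT; group_lia H.
case=> g1 [P1 [Q1 [T1 [hP1 le_m1 sT1]]]].
have [|[[g2 x2] y2] /= [hxy le_xy] min_g2] := @exists_minimizer _
  (fun c : H * H * H => h * c.1.1 = c.1.1 * quad c.1.2 c.2 /\
     (len c.1.2 + len c.2 <= m + (5 * dl + 2))%N) (fun c => len c.1.1).
  exists (g1, P1 * T1^-1, T1 * Q1) => /=; split;
    first by rewrite -hexagon_collapse.
  by have := lenM P1 T1^-1; have := lenM T1 Q1; rewrite lenV; group_lia H.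
have {}min_g2 g' x' y' : h * g' = g' * quad x' y' ->
    (len x' + len y' <= m + (5 * dl + 2))%N -> (len g2 <= len g')%N.
  by move=> hg' le_m'; apply: (min_g2 (g', x', y')).
have hxy1 := quad_rotate hxy.
have [[lx ly]|] : (15 * dl + 6 < len x2)%N /\ (15 * dl + 6 < len y2)%N \/
    exists g' x' y', h * g' = g' * quad x' y' /\ (len y' <= 15 * dl + 6)%N.
- have [sy|ly] := leqP (len y2) (15 * dl + 6); first by right;
  exists g2, x2, y2.
  have [sx|lx] := leqP (len x2) (15 * dl + 6); last by left.
  by right; do 3!eexists; split; [exact: hxy1|rewrite lenV].
- have [|||near bound] := long_quad hxy min_m le_xy (k := 12 * dl + 5).
  1-3: by group_lia H.
  exists g2; last first.
    apply: Or32; exists x2, y2; split=> // i /near[]; split; group_lia H.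
  have gx : (len g2 <= len (g2 * x2))%N by apply: min_g2 hxy1 _; rewrite lenV;
    group_lia H.
  have gy : (len g2 <= len (g2 * y2))%N.
    by apply: min_g2 (quad_rotateV hxy) _; rewrite lenV; group_lia H.
  by have := bound gx gy; group_lia H.
case=> g3 [x3 [y3 [hxy3 sy3]]].
have [|[[g4 x4] y4] /= [hxy4 sy4] min_x] := @exists_minimizer _
  (fun c : H * H * H => h * c.1.1 = c.1.1 * quad c.1.2 c.2 /\
     (len c.2 <= 15 * dl + 6)%N) (fun c => len c.1.2).
  by exists (g3, x3, y3).
have {}min_x g' x' y' : h * g' = g' * quad x' y' ->
    (len y' <= 15 * dl + 6)%N -> (len x4 <= len x')%N.
  by move=> hg' le_y'; apply: (min_x (g', x', y')).
have [|[[g5 x5] y5] /= [hxy5 sy5 sx5] min_g5] := @exists_minimizer _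
  (fun c : H * H * H => [/\ h * c.1.1 = c.1.1 * quad c.1.2 c.2,
     (len c.2 <= 15 * dl + 6)%N & (len c.1.2 <= len x4)%N]) (fun c => len
       c.1.1).
  by exists (g4, x4, y4).
have [|||cor bound] := short_quad (k := 2 * M + 3 * (15 * dl + 6) + 2 * dl)
  hxy5 sy5.
- by move=> g' x' y' hg' /(min_x _ _ _ hg'); apply: leq_trans.
- move=> g' x' y' hg' sy' sx'; apply: (min_g5 (g', x', y')); split=> //=.
  exact: leq_trans sx' sx5.
- by [].
(* The additive constant from [short_quad] is [164 * dl + 6 * M + 64]; [M_gt0] compensates for
   [64 > 56]. *)
exists g5; first by group_lia H.
by apply: Or33; exists x5, y5; split=> //; group_lia H.
Qed.
End Metric.

(** * Words *)

Section Words.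
Local Open Scope group_scope.
Variables (X : finType) (H : groupType) (gen : X -> H).
Local Notation eval := (eval gen).

Lemma eval_nil : eval [::] = 1.
Proof. by rewrite /Defs.eval big_nil. Qed.

Lemma eval_cat u v : eval (u ++ v) = eval u * eval v.
Proof. by rewrite /Defs.eval big_cat. Qed.

Lemma inv_wordK : involutive (@inv_word X).
Proof.
move=> w; rewrite /inv_word map_rev revK mapK // => -[x b].
by rewrite /inv_letter /= negbK.
Qed.

Lemma size_inv_word (w : word X) : size (inv_word w) = size w.
Proof. by rewrite size_rev size_map. Qed.

Lemma eval_inv w : eval (inv_word w) = (eval w)^-1.
Proof.
elim: w => [|[x b] w IH]; first by rewrite eval_nil invg1.
rewrite /inv_word map_cons rev_cons -cats1 eval_cat [eval (rev _)]IH.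
rewrite -[_ :: w]cat1s eval_cat invgM; congr (_ * _).
by rewrite /Defs.eval !big_seq1 /eval_letter /=; case: b; rewrite ?invgK.
Qed.

Lemma eval_segment s t (F : word X) : (s <= t)%N ->
  eval (drop s (take t F)) = (eval (take s F))^-1 * eval (take t F).
Proof.
move=> le_st; rewrite -{2}(cat_take_drop s (take t F)) eval_cat.
by rewrite take_takel // mulKg.
Qed.

Lemma eval_drop t (F : word X) : eval (drop t F) = (eval (take t F))^-1 * eval
  F.
Proof. by rewrite -{3}(cat_take_drop t F) eval_cat mulKg. Qed.

Lemma drop_segment s t (F : word X) : (s <= t)%N ->
  drop s F = drop s (take t F) ++ drop t F.
Proof.
move=> le_st; rewrite -{1}(cat_take_drop t F) drop_cat size_take_min.
have [//|le_s] := ltnP; rewrite [drop s (take _ _)]drop_oversize ?size_take_min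
  //.
have [lt|ge] := leqP t (size F).
  by rewrite (_ : s = t) ?subnn ?drop0 //; lia.
by rewrite (drop_oversize (ltnW ge)).
Qed.

Hypothesis surj : forall g : H, exists w : word X, eval w = g.

Lemma geodesic_words : exists geo : H -> word X,
  forall g, minimal gen (geo g) /\ eval (geo g) = g.
Proof.
have /choice[geo geoP] : forall g, exists w, minimal gen w /\ eval w = g.
  move=> g; have [w <-] := surj g.
  by have [v [min_v eq_v _]] := lenH_spec gen w; exists v.
by exists geo.
Qed.

Section Geo.
Variable geo : H -> word X.
Hypothesis geoP : forall g, minimal gen (geo g) /\ eval (geo g) = g.
Let len g := size (geo g).

Lemma size_geo g : size (geo g) = len g. Proof. by []. Qed.

Lemma len_eval w : (len (eval w) <= size w)%N.
Proof. by have [min_g eq_g] := geoP (eval w); apply: min_g; rewrite /eqH eq_g.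
  Qed.

Lemma lenHE w : lenH gen w = len (eval w).
Proof.
have [v [min_v vw <-]] := lenH_spec gen w.
have [min_g eq_g] := geoP (eval w); apply/eqP; rewrite eqn_leq min_g ?min_v //.
  by rewrite /eqH eq_g vw.
by rewrite /eqH eq_g.
Qed.

Lemma minimalP w : minimal gen w <-> size w = len (eval w).
Proof.
split=> [min_w|sw v vw]; last by rewrite sw -vw len_eval.
apply/eqP; rewrite eqn_leq len_eval min_w //.
by rewrite /eqH; case: (geoP (eval w)).
Qed.

Lemma geoE g : eval (geo g) = g. Proof. by case: (geoP g). Qed.

Lemma len_cat x y : (len (x * y) <= len x + len y)%N.
Proof. by rewrite -{1}(geoE x) -{1}(geoE y) -eval_cat -size_cat len_eval. Qed.

Lemma len_invg x : len x^-1 = len x.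
Proof.
have le g : (len g^-1 <= len g)%N.
  by rewrite -{1}(geoE g) -eval_inv (leq_trans (len_eval _)) // size_inv_word.
by apply/eqP; rewrite eqn_leq le -{1}(invgK x) le.
Qed.

Lemma minimal_take t w : minimal gen w -> (t <= size w)%N ->
  len (eval (take t w)) = t /\ (t + len ((eval (take t w))^-1 * eval w))%N =
    len (eval w).
Proof.
move=> /minimalP sw le_t; rewrite -eval_drop.
have := len_eval (take t w); have := len_eval (drop t w).
have := len_cat (eval (take t w)) (eval (drop t w)).
rewrite -eval_cat cat_take_drop size_drop size_take_min; lia.
Qed.

Variable R : realType.

Lemma delta_thin_ge0 (delta : R) : delta_thin gen delta -> (0 <= delta)%R.
Proof.
have min_nil : minimal gen [::] by [].
have len_nil : len 1 = 0%N.
  by have := len_eval [::]; rewrite eval_nil leqn0 => /eqP.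
move=> /(_ [::] [::] [::] [::] min_nil min_nil erefl).
by rewrite lenHE /= eval_nil len_nil addr0 subr0 mul0r; apply.
Qed.

(** Lengths are integers, so [delta] may be rounded down. Minimal words through an intermediate
    point concatenate to a minimal word because the lengths add up. *)
Lemma thin_metric_words (delta : R) : delta_thin gen delta ->
  thin_metric (fun x y => len (x^-1 * y)) (Num.truncn delta).
Proof.
move=> thin; have delta_ge0 := delta_thin_ge0 thin.
split.
- by move=> x; have := len_eval [::]; rewrite eval_nil mulVg leqn0 => /eqP.
- by move=> x y; rewrite -len_invg invgM invgK.
- by move=> x y z; rewrite -[x^-1 * z](_ : (x^-1 * y) * (y^-1 * z) = _)
  ?len_cat //; reduce_group.
- move=> x y t le_t; have [min_w ew] := geoP (x^-1 * y).
  have [lt_t dr_t] := minimal_take min_w le_t.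
  exists (x * eval (take t (geo (x^-1 * y)))); first by rewrite mulKg.
  by move: dr_t; rewrite ew invgM mulgA.
move=> p x y u v t pu ux pv vy le_t.
have step a b c : (len (a^-1 * b) + len (b^-1 * c) = len (a^-1 * c))%N ->
    minimal gen (geo (a^-1 * b) ++ geo (b^-1 * c)).
  move=> abc; apply/minimalP; rewrite size_cat !size_geo abc.
  by rewrite eval_cat !geoE; congr len; reduce_group.
have sym a b : len (a^-1 * b) = len (b^-1 * a) by rewrite -len_invg invgM invgK.
have := thin (geo (x^-1 * u)) (geo (u^-1 * p)) (geo (p^-1 * v)) (geo (v^-1 *
  y)).
cbv zeta; rewrite !lenHE !eval_cat !geoE !size_cat !size_geo.
have -> : u^-1 * p * (p^-1 * v) = u^-1 * v by reduce_group.
have -> : x^-1 * u * (u^-1 * p) * (p^-1 * v * (v^-1 * y)) = x^-1 * y by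
  reduce_group.
move=> th; rewrite truncn_ge_nat //; apply: th.
- by apply: step; rewrite (sym x u) (sym u p) (sym x p) pu addnC.
- by apply: step; rewrite pv.
- by rewrite sym pu pv.
rewrite -natrD ler_pdivlMr ?ltr0n // lerBrDr -natrM -natrD ler_nat.
rewrite (sym x u) (sym u p) pu pv; lia.
Qed.

Lemma ball_card_bound (r : R) n (f : nat -> H) :
  (forall i, (i < n)%N -> ((len (f i))%:R <= r)%R) ->
  (forall i j, (i < j < n)%N -> f i <> f j) -> (n <= ball_card gen r)%N.
Proof.
move=> le_r f_neq; rewrite /ball_card.
have <- : size [seq f i | i <- iota 0 n] = n by rewrite size_map size_iota.
apply: uniq_leq_size.
  rewrite map_inj_in_uniq ?iota_uniq // => i j.
  rewrite !mem_iota /= !add0n => lt_i lt_j eq_f.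
  by apply/eqP; case: ltngtP => // lt; [have := f_neq i j|have := f_neq j i];
    rewrite lt ?lt_i ?lt_j eq_f => /(_ isT).
move=> g /mapP[i]; rewrite mem_iota /= add0n => lt_i ->.
rewrite in_fset_set; last exact: finite_ball.
by apply/mem_set; exists (geo (f i)); [exact: le_r|exact: geoE].
Qed.

(** * Reading the forms off the minimal word *)

Section Forms.
Variable dl : nat.
Hypothesis dT : thin_metric (fun x y => len (x^-1 * y)) dl.

Lemma near_prefix F x k : minimal gen F ->
  (len x + len (x^-1 * eval F) <= len (eval F) + k)%N ->
  exists2 t, (t <= size F)%N /\
    (2 * t <= len (eval F) + len x - len (x^-1 * eval F) < 2 * t + 2)%N &
    (2 * len (x^-1 * eval (take t F)) <= 2 * dl + k + 1)%N.
Proof.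
move=> min_F near; have [t] := close_to_geodesic dT 1 (eval F) x.
rewrite /= invg1 !mul1g => -[t_def le_t] close; exists t.
  by split=> //; move/minimalP: min_F => ->.
have [|lt_t dr_t] := @minimal_take t F min_F;
  first by move/minimalP: min_F => ->.
have := close (eval (take t F)) k; rewrite mul1g lt_t => /(_ erefl dr_t near).
by rewrite -len_invg invgM invgK.
Qed.

(** [t i] is the rounded Gromov product at 1 of [c i] and the end point, which is nondecreasing by
    [passes_near]. *)
Lemma path_prefixes (c : nat -> H) n k F :
  c 0 = 1 -> minimal gen F -> eval F = c n -> passes_near len c n k ->
  exists t : nat -> nat,
    [/\ forall i, (i.+1 < n)%N -> (t i <= t i.+1)%N,
        forall i, (i < n)%N -> (t i <= size F)%N
      & forall i, (i < n)%N ->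
          (2 * len ((c i)^-1 * eval (take (t i) F)) <= 2 * dl + k + 1)%N].
Proof.
move=> c0 min_F eF near.
have /choice[t tP] : forall i, exists t, (i < n)%N -> [/\ (t <= size F)%N,
    (2 * t <= len (c n) + len (c i) - len ((c i)^-1 * c n) < 2 * t + 2)%N &
    (2 * len ((c i)^-1 * eval (take t F)) <= 2 * dl + k + 1)%N].
  move=> i; have [lt_i|] := ltnP i n; last by exists 0.
  have [near_i _ _] := near i lt_i; rewrite c0 invg1 !mul1g -eF in near_i *.
  by have [t [] ? ? ?] := near_prefix min_F near_i; exists t.
exists t; split=> [i lt_i|i /tP[] //|i /tP[] //].
have [_ mono1 mono2] := near i (ltnW lt_i); rewrite c0 invg1 !mul1g in mono1.
by have [_ t1 _] := tP i (ltnW lt_i); have [_ t2 _] := tP i.+1 lt_i;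
  group_lia H.
Qed.

(** [F] is cut near the five inner vertices, and [e1] to [e5] are the jumps from vertices to cuts.
    Segments along a side and its inverse differ by jumps; each jump occurs twice in the connecting
    words, whence the factor 5. *)
Lemma form4_hexagon (P Q T : H) F k (K : R) :
  minimal gen F -> eval F = hexagon P Q T ->
  passes_near len (hexagon_path P Q T) 6 k ->
  ((5 * (2 * dl + k + 1))%N%:R <= 12 * K)%R -> form4 gen K F.
Proof.
move=> min_F eF near leK.
have [t [mono tF close]] := path_prefixes erefl min_F eF near.
have {}mono : [/\ (t 1 <= t 2)%N, (t 2 <= t 3)%N, (t 3 <= t 4)%N & (t 4 <= t
  5)%N].
  by split; apply: mono.
have {}close := (close 1%N isT, close 2%N isT, close 3%N isT, close 4%N isT,
  close 5%N isT).
rewrite /hexagon_path /= in close.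
move: {tF near} (t 1%N) (t 2%N) (t 3%N) (t 4%N) (t 5%N) mono close.
move=> t1 t2 t3 t4 t5 [le12 le23 le34 le45].
move e1E : (_ * eval (take t1 F)) => e1; move e2E : (_ * eval (take t2 F)) =>
  e2.
move e3E : (_ * eval (take t3 F)) => e3; move e4E : (_ * eval (take t4 F)) =>
  e4.
move e5E : (_ * eval (take t5 F)) => e5 [[[[l1 l2] l3] l4] l5].
exists (take t1 F), (drop t1 (take t2 F)), (drop t2 (take t3 F)),
  (inv_word (drop t3 (take t4 F))), (inv_word (drop t4 (take t5 F))),
  (inv_word (drop t5 F)), (geo e4), (geo (e4^-1 * e2)), (geo e2^-1),
  (geo (e3^-1 * e1)), (geo (e1^-1 * e5)), (geo (e5^-1 * e3)).
rewrite !inv_wordK -drop_segment // -drop_segment // -drop_segment //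
  -drop_segment //.
rewrite cat_take_drop; split=> //; rewrite /eqH !eval_cat !geoE !eval_inv.
rewrite !eval_segment // !eval_drop eF /hexagon.
split; first by rewrite -e1E -e2E -e3E -e4E -e5E; split; reduce_group.
split; last by rewrite eval_nil; split; reduce_group.
apply: le_trans leK; rewrite ler_nat.
have := len_cat e4^-1 e2; have := len_cat e3^-1 e1; have := len_cat e1^-1 e5.
have := len_cat e5^-1 e3; rewrite !len_invg; have := len_invg e2;
  rewrite !size_geo; group_lia H.
Qed.

Lemma form3_quad (x y : H) F k (K : R) :
  minimal gen F -> eval F = quad x y -> passes_near len (quad_path x y) 4 k ->
  ((3 * (2 * dl + k + 1))%N%:R <= 12 * K)%R -> form3 gen K F.
Proof.
move=> min_F eF near leK.
have [t [mono tF close]] := path_prefixes erefl min_F eF near.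
have {}mono : (t 1 <= t 2)%N /\ (t 2 <= t 3)%N by split; apply: mono.
have {}close := (close 1%N isT, close 2%N isT, close 3%N isT).
rewrite /quad_path /= in close.
move: {tF near} (t 1%N) (t 2%N) (t 3%N) mono close => t1 t2 t3 [le12 le23].
move e1E : (_ * eval (take t1 F)) => e1; move e2E : (_ * eval (take t2 F)) =>
  e2.
move e3E : (_ * eval (take t3 F)) => e3 [[l1 l2] l3].
exists (take t1 F), (drop t1 (take t2 F)), (inv_word (drop t2 (take t3 F))),
  (inv_word (drop t3 F)), (geo e3), (geo (e3^-1 * e2)), (geo (e2^-1 * e1)),
  (geo e1^-1).
rewrite !inv_wordK -drop_segment // -drop_segment // cat_take_drop.
rewrite /eqH !eval_cat !geoE !eval_inv !eval_segment // !eval_drop eF /quad.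
split=> //; last by rewrite eval_nil; reduce_group.
- by rewrite -e1E -e2E -e3E; reduce_group.
- by rewrite -e1E -e2E -e3E; reduce_group.
apply: le_trans leK; rewrite ler_nat.
have := len_cat e3^-1 e2; have := len_cat e2^-1 e1; rewrite !len_invg.
have := len_invg e1; rewrite !size_geo; group_lia H.
Qed.

(** One cut, near the vertex [x], suffices: if [e] is the jump to it, the connecting elements are
    [y] and [e^-1 * y * e]. *)
Lemma form2_quad (x y : H) F k (K : R) :
  minimal gen F -> eval F = quad x y ->
  (len x + len (y * x^-1 * y^-1) <= len (quad x y) + k)%N ->
  ((2 * len y + 2 * dl + k + 1)%N%:R <= 12 * K)%R -> form2 gen K F.
Proof.
move=> min_F eF near leK.
have [||t _ le_e] := @near_prefix F x k => //.
  by rewrite eF {1}/quad; move: near; reduce_group.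
move: le_e; move eE : (x^-1 * _) => e le_e.
exists (take t F), (inv_word (drop t F)), (geo y), (geo (e^-1 * y * e)).
rewrite inv_wordK cat_take_drop /eqH !eval_cat !eval_inv !geoE eval_drop eF.
split=> //.
- by rewrite -eE /quad; reduce_group.
- apply: le_trans leK; rewrite ler_nat.
  have := len_cat (e^-1 * y) e; have := len_cat e^-1 y.
  by rewrite len_invg !size_geo; group_lia H.
by exists e^-1; rewrite !geoE; reduce_group.
Qed.
End Forms.
End Geo.
End Words.

(** * Constants and assembly *)

Local Open Scope ring_scope.

(** Since 6 is at least 4; this gives [l >= 3 * dl]. *)
Lemma ln6_ln2_ge2 (R : realType) : 2 <= ln 6 / ln 2 :> R.
Proof.
have ln2_gt0 : 0 < ln 2 :> R by rewrite ln_gt0 // ltr1n.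
rewrite ler_pdivlMr // mulr_natl -lnXn ?ltr0n //.
by rewrite ler_ln ?posrE ?exprn_gt0 ?ltr0n // -natrX ler_nat.
Qed.

Theorem proposition5p1 (R : realType) (X : finType) (H : groupType)
    (gen : X -> H) (rels : set (word X)) (delta : R)
    (presH : presents gen rels) (thinH : delta_thin gen delta)
    (h : word X) (comm_h : is_commutatorH gen h) :
  let M : R := (ball_card gen (4 * delta))%:R in
  let l : R := delta * (ln 6 / ln 2 + 1) in
  let K : R := 12 * l + M + 4 in
  exists W F : word X,
    [/\ minimal gen W,
        minimal gen F,
        eqH gen h (W ++ F ++ inv_word W),
        (size W)%:R <= 59 * l + 8 * M + 28 + 2 * delta + (lenH gen h)%:R / 2
      & [\/ form1 gen K F, form2 gen K F, form3 gen K F | form4 gen K F]].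
Proof.
move=> M l K; have [surj _] := presH.
have [geo geoP] := geodesic_words surj.
have dT := thin_metric_words geoP thinH; have delta_ge0 := delta_thin_ge0 geoP
  thinH.
pose dl := Num.truncn delta; pose m := ball_card gen (4 * delta).
have dl_le : dl%:R <= delta by rewrite truncn_le.
have l_ge : 3 * dl%:R <= l.
  have := ln6_ln2_ge2 R; rewrite /l => ln_ge.
  by rewrite mulrC ler_pM ?ler0n //; lra.
have [x [y hxy]] := comm_h.
(* Here [[~ x, y]] is [x^-1 * y^-1 * x * y], hence the inverses. *)
have h_quad : eval gen h = quad x^-1%g y^-1%g.
  by rewrite hxy /quad commgEl conjgE; reduce_group.
have ballm n (f : nat -> H) :
    (forall i, (i < n)%N -> (size (geo (f i)) <= 4 * dl)%N) ->
    (forall i j, (i < j < n)%N -> f i <> f j) -> (n <= m)%N.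
  move=> le_f; apply: (ball_card_bound geoP) => i /le_f;
    rewrite -(ler_nat R) natrM => le_i.
  by apply: le_trans le_i _; rewrite ler_pM2l ?ltr0n.
have [g g_le cases] :=
  commutator_conjugate (len := fun z => size (geo z)) dT ballm h_quad.
pose F := geo (g^-1 * eval gen h * g)%g.
have [min_W eW] := geoP g; have [min_F eF] := geoP (g^-1 * eval gen h * g)%g.
exists (geo g), F; split=> //.
- by rewrite /eqH !eval_cat eval_inv eW eF; reduce_group.
(* Doubling the wanted bound and using [l >= 3 * dl] yields
   [(2 * 59 * 3 + 2 * 2) * dl = 358 * dl]. *)
- rewrite (lenHE geoP); move: g_le; rewrite -(ler_nat R) -/dl => g_le.
  by rewrite /M -/m; lra.
have hF z : (eval gen h * g = g * z)%g -> eval gen F = z.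
  by rewrite eF => hg; rewrite -mulgA hg mulKg.
have leK N : (N <= 12 * (36 * dl + m + 4))%N -> N%:R <= 12 * K.
  rewrite -(ler_nat R) => le_N.
  by apply: le_trans le_N _; rewrite /K /M -/m; lra.
case: cases => [[P [Q [T [hg near]]]]|[x' [y' [hg near]]]|[x' [y' [hg le_y
  near]]]].
- apply: Or44; apply: (form4_hexagon geoP dT min_F (hF _ hg) near).
  by apply: leK; rewrite -/dl; lia.
- apply: Or43; apply: (form3_quad geoP dT min_F (hF _ hg) near).
  by apply: leK; rewrite -/dl; lia.
apply: Or42; apply: (form2_quad geoP dT min_F (hF _ hg) (k := (2 * m + 47 * dl
  + 18)%N)).
  by move: near; rewrite -/dl; lia.
by apply: leK; move: le_y; rewrite -/dl; lia.
Qed.
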